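(* Let $\Gamma=(V,E)$ be a finite directed multigraph that has an Euler circuit, with vertices $v_1,\dots,v_n$, and let $\tilde\Gamma$ be a $k$-fold cover of $\Gamma$. Let $\mathcal E(\cdot)$ denote the number of Euler circuits of a graph. Then $$\frac{\mathcal E(\tilde\Gamma)}{\mathcal E(\Gamma)}=\frac1k\,\det[\mathscr L(\Gamma)]_{\mathbb Z[E]}\Big|_{\mathrm{wt}=1}\cdot\prod_{v}\bigl((\deg v-1)!\bigr)^{k-1},$$ where the product is over the vertices $v$ of $\Gamma$, $\deg v$ is the outdegree of $v$, and $|_{\mathrm{wt}=1}$ means that all edge weights are specialized to $1$. This quantity is a positive integer.
   Context: An Euler circuit in a directed graph is a (closed, directed) cycle that uses each edge of the graph precisely once; Euler circuits are counted up to the choice of starting point (cyclic rotation), and parallel edges are distinguished. A graph has an Euler circuit precisely when it is connected and every vertex has indegree equal to outdegree. Loops and multiple edges are allowed. Edges $e$ of $\Gamma$ carry weights $\mathrm{wt}(e)$ that are distinct indeterminates, and $\mathbb Z[E]$ is the polynomial ring over $\mathbb Z$ in them. $E_s(w)$ (resp. $E_t(w)$) is the set of edges with source (resp. target) $w$; $e=(v,w)$ means $e$ has source $v$ and target $w$. A $k$-fold cover of $\Gamma$ is a graph $\tilde\Gamma=(\tilde V,\tilde E)$ with a map $\pi:\tilde\Gamma\to\Gamma$ sending vertices to vertices and edges to edges, compatible with sources and targets, such that $|\pi^{-1}(v)|=|\pi^{-1}(e)|=k$ for all $v\in V,e\in E$, $\mathrm{wt}(\tilde e)=\mathrm{wt}(\pi(\tilde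 e))$ for all $\tilde e\in\tilde E$, and $\pi$ is a local homeomorphism, i.e. $\pi$ restricts to bijections $E_s(\tilde v)\to E_s(\pi(\tilde v))$ and $E_t(\tilde v)\to E_t(\pi(\tilde v))$ for every $\tilde v\in\tilde V$. A cover is not required to be connected. The matrix: label the lifts of $v_i$ (elements of $\pi^{-1}(v_i)$) as $v_i^1,\dots,v_i^k$. Define $n(k-1)\times n(k-1)$ matrices $D$ (diagonal) and $A$, with rows and columns indexed by $v_1^2,\dots,v_n^2,\dots,v_1^k,\dots,v_n^k$, by $$D[v_i^t,v_i^t]=\sum_{e\in E_s(v_i^t)}\mathrm{wt}(e),\qquad A[v_i^t,v_j^r]=\sum_{e=(v_i^t,v_j^r)}\mathrm{wt}(e)-\sum_{e=(v_i^t,v_j^1)}\mathrm{wt}(e)\qquad(1<t,r\le k),$$ where edges are those of $\tilde\Gamma$, and set $[\mathscr L(\Gamma)]_{\mathbb Z[E]}:=D-A$.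
   Formalization: The formula and integrality are proved for all k-fold covers, but positivity only for connected covers: a disconnected cover has no Euler circuit, so the quantity is then 0 (e.g. the trivial 2-fold cover of a single loop). *)

(* Defs.v *)
From HB Require Import structures.
From mathcomp Require Import all_boot all_order all_algebra.
From mathcomp Require Import mpoly.

Set Implicit Arguments.
Unset Strict Implicit.
Unset Printing Implicit Defensive.

Import Order.TTheory GRing.Theory Num.Theory.
Local Open Scope ring_scope.

Record digraph := Digraph {
  vertex : finType;
  edge : finType;
  src : edge -> vertex;
  tgt : edge -> vertex
}.

Section Digraphs.
Variable G : digraph.

Definition out_edges (v : vertex G) : {set edge G} := [set e | src e == v].
Definition in_edges (v : vertex G) : {set edge G} := [set e | tgt e == v].
Definition edges_from_to (v w : vertex G) : {set edge G} :=
  [set e | (src e == v) && (tgt e == w)].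

Definition outdeg (v : vertex G) : nat := #|out_edges v|.

Definition adjacent : rel (vertex G) :=
  fun v w => [exists e : edge G,
    (src e == v) && (tgt e == w) || (src e == w) && (tgt e == v)].

(* Connectedness of the underlying undirected graph. *)
Definition connected : Prop := forall v w : vertex G, connect adjacent v w.

(* An Euler circuit with a chosen first edge.  A circuit has at least one edge,
   and it has to pass through every vertex: otherwise a graph with isolated
   vertices could have an Euler circuit without being connected. *)
Definition euler_tour (s : #|edge G|.-tuple (edge G)) : bool :=
  [&& s != [::] :> seq (edge G),
      cycle (fun e f => tgt e == src f) s,
      [forall e, count_mem e s == 1%N]
    & [forall v, has (fun e => src e == v) s]].

Definition same_circuit : rel (#|edge G|.-tuple (edge G)) :=
  fun s t => [exists i : 'I_#|edge G|.+1, t == rot i s :> seq (edge G)].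

Definition euler_circuits : {set {set #|edge G|.-tuple (edge G)}} :=
  equivalence_partition same_circuit [set s | euler_tour s].

Definition num_euler_circuits : nat := #|euler_circuits|.

Definition has_euler_circuit : Prop := exists s, euler_tour s.

End Digraphs.

Section Covers.
Variables G H : digraph.
Variables (pV : vertex H -> vertex G) (pE : edge H -> edge G).

Record kfold_cover (k : nat) : Prop := KfoldCover {
  cover_src : forall e, src (pE e) = pV (src e);
  cover_tgt : forall e, tgt (pE e) = pV (tgt e);
  cover_fiberV : forall v : vertex G, #|pV @^-1: [set v]| = k;
  cover_fiberE : forall e : edge G, #|pE @^-1: [set e]| = k;
  cover_out_inj : forall v, {in out_edges v &, injective pE};
  cover_out_onto : forall v, pE @: out_edges v = out_edges (pV v);
  cover_in_inj : forall v, {in in_edges v &, injective pE};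
  cover_in_onto : forall v, pE @: in_edges v = in_edges (pV v)
}.

(* Z[E]: one indeterminate for each edge of the base graph G. *)
Definition ZE := {mpoly int[#|edge G|]}.

Definition wt (e : edge G) : ZE := 'X_(enum_rank e).

(* The weight of an edge of the cover is that of its projection. *)
Definition cwt (e : edge H) : ZE := wt (pE e).

Variables (n k : nat).

(* [vl i] enumerates without repetition the fibre over [v i]. *)
Definition lift_labelling (v : 'I_n -> vertex G)
    (vl : 'I_n -> 'I_k.+1 -> vertex H) : Prop :=
  forall i, injective (vl i) /\ [set vl i t | t : 'I_k.+1] = pV @^-1: [set v i].

Variable vl : 'I_n -> 'I_k.+1 -> vertex H.

(* The lifts v_i^1, v_i^2, ..., v_i^{k+1} of the i-th vertex are
   [vl i ord0] and [vl i (lift ord0 t)] for [t : 'I_k].  Rows and columns of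
   the matrices below are indexed by pairs (t, i), ordered by t first. *)
Definition cover_D : 'M[ZE]_(\sum_(t < k) n) :=
  \mxdiag_(t < k) diag_mx
    (\row_(i < n) \sum_(e in out_edges (vl i (lift ord0 t))) cwt e).

Definition cover_A : 'M[ZE]_(\sum_(t < k) n) :=
  \mxblock_(t < k, r < k) \matrix_(i < n, j < n)
    (\sum_(e in edges_from_to (vl i (lift ord0 t)) (vl j (lift ord0 r))) cwt e
     - \sum_(e in edges_from_to (vl i (lift ord0 t)) (vl j ord0)) cwt e).

Definition cover_laplacian : 'M[ZE]_(\sum_(t < k) n) := cover_D - cover_A.

End Covers.

(* Main.v *)
Require Import Defs.
From HB Require Import structures.
From mathcomp Require Import all_boot all_order all_algebra.
From mathcomp Require Import fingroup perm.
From mathcomp Require Import mpoly ring.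

Set Implicit Arguments.
Unset Strict Implicit.
Unset Printing Implicit Defensive.

Import Order.TTheory GRing.Theory Num.Theory.
Local Open Scope ring_scope.

(** Both sides of the identity are governed by one number attached to a graph
    in which every vertex has as many incoming as outgoing edges: since the
    rows and the columns of its Laplacian [L] sum to zero, all the cofactors of
    [L] are equal.

    An Euler circuit is the same as a permutation [q] of the edges that has a
    single cycle and sends every edge [e] to an edge leaving the target of [e].
    The number of these [transitions] is the common cofactor of [L] times the
    product of the [(deg v - 1)!] ([card_transitions]; this is the BEST theorem
    of de Bruijn, van Aardenne-Ehrenfest, Smith and Tutte, with the cofactor in
    the role of the number of spanning trees).  Trees are avoided by an
    induction that splits an edge [e] off a vertex [v] of outdegree [d > 1]: [e]
    becomes the only edge that leaves a new vertex, and some edge [g0] entering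
    [v] is redirected to it.  The permutations are sorted by the edge [g0] that
    they send to [e].  On the other side the minors of the split Laplacians
    differ in a single column, and the sum of these columns over [g0] is [d - 1]
    times a column of a rank-one perturbation of [L], so the cofactors add up to
    [d - 1] times the cofactor of [L] ([sum_cofactor_split]).  When all the
    outdegrees are [1] there is one permutation to consider, and a cofactor of
    [1 - P] tells whether the permutation matrix [P] is a single cycle
    ([cofactor_base]).

    For a cover [H -> G] of degree [k + 1], adding the rows of each fibre to the
    row of its first vertex, and undoing this on the columns, turns the
    Laplacian of [H] into a block triangular matrix with diagonal blocks the
    Laplacian of [G] and the cover Laplacian [C] ([det_fibre_sums]).  Both
    Laplacians are singular, so this is applied after a rank-one perturbation
    which spreads over a fibre of [H] and therefore picks up [k + 1] equal
    cofactors: [k + 1] times the cofactor of [H] is the cofactor of [G] times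
    [det C] ([cofactor_cover]).  As a vertex and its lifts have the same
    outdegree, the formula for the quotient follows.

    The quotient is an integer because every row of [C] has a sum divisible by
    [k + 1], and hence so has [det C] ([dvdz_det_cover]).  It is positive when
    [H] is connected because the quadratic form of the Laplacian of a balanced
    graph is half the sum over the edges of the squares of the differences of
    the end values, so its kernel is reduced to the constants
    ([cofactor_connected_neq0]). *)

(** * Cofactors of matrices with vanishing row and column sums *)

Lemma sum_delta (R : pzRingType) (I : finType) (k : I) (F : I -> R) :
  \sum_y (y == k)%:R * F y = F k.
Proof.
by rewrite (bigD1 k) //= eqxx mul1r big1 ?addr0 // => y /negPf->; rewrite mul0r.
Qed.

Lemma sum_delta1 (R : pzRingType) (I : finType) (k : I) :
  \sum_y (k == y)%:R = 1 :> R.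
Proof.
rewrite -[RHS](sum_delta k (fun=> 1)); apply: eq_bigr => y _.
by rewrite mulr1 eq_sym.
Qed.

Section Cofactors.
Variable R : comNzRingType.

Lemma eq_cofactor_row n (A B : 'M[R]_n) i j :
  (forall a b, a != i -> A a b = B a b) -> cofactor A i j = cofactor B i j.
Proof.
move=> eqAB; congr (_ * \det _); apply/matrixP=> a b; rewrite !mxE.
by apply: eqAB; rewrite eq_sym neq_lift.
Qed.

Lemma eq_cofactor_col n (A B : 'M[R]_n) i j :
  (forall a b, b != j -> A a b = B a b) -> cofactor A i j = cofactor B i j.
Proof.
move=> eqAB; congr (_ * \det _); apply/matrixP=> a b; rewrite !mxE.
by apply: eqAB; rewrite eq_sym neq_lift.
Qed.

Lemma det_add_row n (A : 'M[R]_n) i (b : 'I_n -> R) :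
  \det (\matrix_(x, y) (A x y + (x == i)%:R * b y))
    = \det A + \sum_y b y * cofactor A i y.
Proof.
rewrite (expand_det_row _ i) (expand_det_row A i) -big_split /=.
apply: eq_bigr => y _; rewrite mxE eqxx mul1r mulrDl.
by congr (_ * _ + _ * _); apply: eq_cofactor_row => x z /negPf nxi;
  rewrite mxE nxi mul0r addr0.
Qed.

End Cofactors.

Section ZeroSums.
Variable R : idomainType.

Lemma det_zero_row_sums n (A : 'M[R]_n) (i0 : 'I_n) :
  (forall i, \sum_j A i j = 0) -> \det A = 0.
Proof.
move=> A0; rewrite -det_tr; apply/eqP/det0P; exists (const_mx 1).
  by apply/eqP => /rowP/(_ i0); rewrite !mxE => /eqP; rewrite oner_eq0.
by apply/rowP=> j; rewrite !mxE -[RHS](A0 j); apply: eq_bigr => i _; rewrite !mxE mul1r.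
Qed.

(** Adding [1] at [(i, j)] and [-1] at [(i, j')] keeps the row sums zero, so the
    determinant stays zero, while it changes by the difference of the two
    cofactors. *)
Lemma cofactor_zero_row_sums n (A : 'M[R]_n) i j j' :
  (forall i, \sum_j A i j = 0) -> cofactor A i j = cofactor A i j'.
Proof.
move=> A0; pose b y : R := (y == j)%:R - (y == j')%:R.
have := det_add_row A i b; rewrite (det_zero_row_sums i A0) add0r.
rewrite (det_zero_row_sums i); last first.
  move=> x; under eq_bigr do rewrite mxE.
  rewrite big_split /= A0 add0r -mulr_sumr.
  under eq_bigr do rewrite /b [_ == j]eq_sym [_ == j']eq_sym.
  by rewrite sumrB !sum_delta1 subrr mulr0.
under eq_bigr do rewrite mulrBl.
by rewrite sumrB !sum_delta => /esym/eqP; rewrite subr_eq0 => /eqP.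
Qed.

Lemma cofactor_zero_sums n (A : 'M[R]_n) i j i' j' :
  (forall i, \sum_j A i j = 0) -> (forall j, \sum_i A i j = 0) ->
  cofactor A i j = cofactor A i' j'.
Proof.
move=> Ar Ac; rewrite (cofactor_zero_row_sums i j j' Ar) -!(cofactor_tr A).
by apply: cofactor_zero_row_sums => y; under eq_bigr do rewrite mxE.
Qed.

End ZeroSums.

(** * Laplacians and edge permutations *)

Section Transitions.
Variables (E : finType) (n : nat).
Implicit Types s t : E -> 'I_n.

(** Graphs are given here by the source [s] and the target [t] of each edge, the
    vertices being numbered. *)
Definition laplacian s t : 'M[int]_n :=
  \matrix_(i, j) \sum_(g | s g == i) ((s g == j)%:R - (t g == j)%:R).

Definition deg s i := #|[pred g | s g == i]|.

Definition balanced s t := forall i, deg s i = deg t i.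

Definition single_cycle (q : {perm E}) := [forall x, forall y, y \in porbit q x].

(** The Euler circuits, seen as the maps from an edge to the next one. *)
Definition transitions s t : {set {perm E}} :=
  [set q : {perm E} | [forall g, s (q g) == t g] && single_cycle q].

Lemma transitionsP s t (q : {perm E}) :
  reflect ((forall g, s (q g) = t g) /\ (forall x y, y \in porbit q x))
          (q \in transitions s t).
Proof.
rewrite inE; apply: (iffP andP) => -[st cyc]; split.
- by move=> g; apply/eqP/(forallP st).
- by move=> x y; apply: (forallP (forallP cyc x)).
- by apply/forallP=> g; rewrite st.
- by apply/forallP=> x; apply/forallP=> y.
Qed.

Lemma degE s i : (deg s i)%:R = \sum_g (s g == i)%:R :> int.
Proof.
rewrite /deg -sum1_card natr_sum big_mkcond; apply: eq_bigr => g _.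
by rewrite inE; case: eqP.
Qed.

Lemma laplacianE s t i j :
  laplacian s t i j = \sum_g (s g == i)%:R * ((s g == j)%:R - (t g == j)%:R).
Proof.
rewrite mxE big_mkcond; apply: eq_bigr => g _.
by case: eqP; rewrite ?mul1r ?mul0r.
Qed.

Lemma laplacian_row_sum s t i : \sum_j laplacian s t i j = 0.
Proof.
under eq_bigr do rewrite mxE.
by rewrite exchange_big big1 //= => g _; rewrite sumrB !sum_delta1 subrr.
Qed.

Lemma laplacian_col_sum s t j : balanced s t -> \sum_i laplacian s t i j = 0.
Proof.
move=> bal; under eq_bigr do rewrite laplacianE.
rewrite exchange_big /=; under eq_bigr do rewrite -mulr_suml sum_delta1 mul1r.
by rewrite sumrB -!degE bal subrr.
Qed.

End Transitions.

(** * Graphs with outdegrees one *)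

Section Base.
Variables (E : finType) (n : nat) (s t : E -> 'I_n) (si : 'I_n -> E).
Hypotheses (sK : cancel s si) (siK : cancel si s) (t_inj : injective t).

Let step_inj : injective (si \o t).
Proof. by move=> x y /= /(can_inj siK); apply: t_inj. Qed.

Let q0 := perm step_inj.

Let sq0 g : s (q0 g) = t g.
Proof. by rewrite permE /= siK. Qed.

Lemma card_transitions_base : #|transitions s t| = single_cycle q0.
Proof.
have only q : q \in transitions s t -> q = q0.
  by case/transitionsP=> st _; apply/permP=> g; rewrite permE /= -st sK.
case cyc: (single_cycle q0).
  rewrite (_ : transitions s t = [set q0]) ?cards1 //.
  apply/setP=> q; rewrite [RHS]inE; apply/idP/eqP=> [/only //|->].
  by rewrite inE cyc andbT; apply/forallP=> g; rewrite sq0.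
case: (set_0Vmem (transitions s t)) => [->|[q q_in]]; first by rewrite cards0.
move: (q_in).
by rewrite (only _ q_in) inE cyc andbF.
Qed.

Let lapE g j : laplacian s t (s g) j = (s g == j)%:R - (t g == j)%:R.
Proof. by rewrite mxE (big_pred1 g) // => h; rewrite (can_eq sK). Qed.

(** The Laplacian is [1 - P] for the permutation matrix [P] of [q0], read on the
    vertices.  If [q0] has several cycles, the indicator of one that avoids the
    deleted vertex is in the kernel of the minor.  If it has a single cycle, a
    nonzero term of the Leibniz expansion follows [q0] from any vertex which it
    moves, hence would move the deleted vertex too; only the identity is left. *)
Lemma cofactor_base i : cofactor (laplacian s t) i i = #|transitions s t|%:R.
Proof.
rewrite card_transitions_base.
(* Replacing row [i] by a unit vector gives the cofactor as a determinant of
   full size. *)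
pose K : 'M[int]_n :=
  \matrix_(x, y) if x == i then (y == i)%:R else laplacian s t x y.
have -> : cofactor (laplacian s t) i i = \det K.
  rewrite (expand_det_row K i) (bigD1 i) //= big1 ?addr0; last first.
    by move=> j /negPf nji; rewrite mxE eqxx nji mul0r.
  rewrite mxE !eqxx mul1r; apply: eq_cofactor_row => a b /negPf nai.
  by rewrite [RHS]mxE nai.
have [/forallP cyc | /forallPn[x /forallPn[y nxy]]] := boolP (single_cycle q0).
  have reach x y : y \in porbit q0 x by apply: (forallP (cyc x)).
  clear cyc.
  rewrite /determinant (bigD1 1%g) //= odd_perm1 expr0 mul1r.
  rewrite big1 => [|j _]; last first.
    rewrite mxE perm1; case: (j =P i) => [//|nji].
    rewrite -[j]siK lapE eqxx; case: eqP => [fix_j|_]; last by rewrite subr0.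
    have fixed m : (q0 ^+ m)%g (si j) = si j.
      elim: m => [|m IHm]; first by rewrite expg0 perm1.
      by rewrite expgSr permM IHm permE /= fix_j siK.
    have /porbitP[m] := reach (si j) (si i); rewrite fixed => /(can_inj siK) ij.
    by rewrite ij in nji.
  rewrite big1 ?addr0 // => sigma n1.
  have /forallPn[a sa] : ~~ [forall a, sigma a == a].
    apply: contra n1 => /forallP all1.
    by apply/eqP/permP=> a; rewrite perm1; apply/eqP.
  apply/eqP; rewrite mulf_eq0 signr_eq0 /=; apply/prodf_eq0.
  have [j Kj|K_n0] := pickP [pred j | K j (sigma j) == 0]; first by exists j.
  have fix_i : sigma i = i.
    by have := K_n0 i; rewrite /= mxE eqxx; case: (sigma i =P i).
  have moved m : sigma (s ((q0 ^+ m)%g (si a))) != s ((q0 ^+ m)%g (si a)).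
    elim: m => [|m IHm]; first by rewrite expg0 perm1 siK.
    rewrite expgSr permM; set g := ((q0 ^+ m)%g (si a)) in IHm *.
    have := K_n0 (s g); rewrite /= mxE.
    have /negPf-> : s g != i by apply: contraNneq IHm => ->; rewrite fix_i.
    rewrite lapE [s g == _]eq_sym (negPf IHm) sub0r oppr_eq0 sq0.
    case: (t g =P sigma (s g)) => // -> _.
    by apply: contra IHm => /eqP/perm_inj->.
  have /porbitP[m si_i] := reach (si a) (si i).
  by have := moved m; rewrite -si_i siK fix_i eqxx.
have [z niz] : exists z, si i \notin porbit q0 z.
  case iy: (si i \in porbit q0 y); last by exists y; rewrite iy.
  exists x; apply: contra nxy => ix.
  move: iy ix; rewrite -!eq_porbit_mem => /eqP<- /eqP<-.
  exact: eqxx.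
rewrite -det_tr; apply/eqP/det0P; exists (\row_j (si j \in porbit q0 z)%:R).
  by apply/eqP=> /rowP/(_ (s z)); rewrite !mxE sK porbit_id.
apply/rowP=> j; rewrite [LHS]mxE [RHS]mxE.
under eq_bigr => b _ do rewrite [_ 0 b]mxE [_^T b j]mxE [K _ _]mxE.
have pick (F : 'I_n -> int) k : \sum_y F y * (k == y)%:R = F k.
  by rewrite -[RHS](sum_delta k); apply: eq_bigr => y' _; rewrite eq_sym mulrC.
case: (j =P i) => [_|nji].
  by under eq_bigr do rewrite eq_sym; rewrite pick (negPf niz).
rewrite -[j]siK; under eq_bigr do rewrite lapE mulrBr.
rewrite sumrB !pick siK.
have -> : si (t (si j)) = q0 (si j) by rewrite permE.
apply/eqP; rewrite subr_eq0; apply/eqP; congr (_%:R).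
congr nat_of_bool; rewrite porbit_sym [RHS]porbit_sym.
by rewrite -(porbit_perm q0 1 (si j)) expg1.
Qed.

End Base.

(** * Splitting an edge off its source *)

Section SplitOff.
Variables (E : finType) (n : nat).
Implicit Types (s t : E -> 'I_n) (e g : E).

(** [ord0] is the new vertex.  The same operation on the target map redirects an
    edge to the new vertex. *)
Definition split_off e s g : 'I_n.+1 := if g == e then ord0 else lift ord0 (s g).

Lemma split_off0 e s g : (split_off e s g == ord0) = (g == e).
Proof.
rewrite /split_off; case: (g == e); first by rewrite eqxx.
by rewrite eq_sym (negPf (neq_lift _ _)).
Qed.

Lemma split_off_lift e s g i :
  (split_off e s g == lift ord0 i) = (g != e) && (s g == i).
Proof.
rewrite /split_off; case: (g == e) => /=; first by rewrite (negPf (neq_lift _ _)).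
by rewrite (inj_eq lift_inj).
Qed.

Lemma deg_split_off0 e s : deg (split_off e s) ord0 = 1%N.
Proof.
rewrite -(card1 e) /deg; apply: eq_card => g.
by rewrite inE split_off0 inE.
Qed.

Lemma deg_split_off e s i :
  deg s i = ((s e == i) + deg (split_off e s) (lift ord0 i))%N.
Proof.
rewrite /deg (cardD1 e) inE; congr (_ + _)%N; apply: eq_card => g.
by rewrite !inE split_off_lift.
Qed.

Lemma balanced_split_off e g0 s t :
  t g0 = s e -> balanced s t -> balanced (split_off e s) (split_off g0 t).
Proof.
move=> tg bal i; case: (unliftP ord0 i) => [j|] ->; last by rewrite !deg_split_off0.
by have := bal j; rewrite (deg_split_off e) (deg_split_off g0 t) tg => /addnI.
Qed.

Lemma transitions_split_off e g0 s t : t g0 = s e ->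
  transitions (split_off e s) (split_off g0 t)
    = [set q in transitions s t | q g0 == e].
Proof.
move=> tg; apply/setP=> q; rewrite [RHS]inE.
apply/transitionsP/andP=> [[st cyc]|[/transitionsP[st cyc] /eqP qg]].
  have qg : q g0 = e by apply/eqP; rewrite -(split_off0 e s) st split_off0.
  rewrite qg; split=> //; apply/transitionsP; split=> // g.
  have [->|ng] := eqVneq g g0; first by rewrite qg.
  have := st g; rewrite /split_off (negPf ng) -qg (inj_eq perm_inj) (negPf ng).
  exact: lift_inj.
split=> // g; rewrite /split_off -qg (inj_eq perm_inj).
by case: eqP => // _; rewrite st.
Qed.

Lemma card_transitions_split e s t :
  #|transitions s t| =
    (\sum_(g0 | t g0 == s e) #|transitions (split_off e s) (split_off g0 t)|)%N.
Proof.
rewrite -sum1_card (partition_big (fun q : {perm E} => (q^-1)%g e)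
                                  (fun g => t g == s e)) /=.
  apply: eq_bigr => g0 /eqP tg; rewrite transitions_split_off // -sum1_card.
  apply: eq_bigl => q; rewrite [RHS]inE; congr (_ && _).
  by apply/eqP/eqP=> [<-|<-]; rewrite ?permKV ?permK.
by move=> q /transitionsP[st _]; rewrite -st permKV.
Qed.

End SplitOff.

Section SplitLaplacian.
Variables (E : finType) (n : nat) (s t : E -> 'I_n) (e : E).
Hypothesis bal : balanced s t.
Let v := s e.

Let M g0 : 'M[int]_n :=
  row' ord0 (col' ord0 (laplacian (split_off e s) (split_off g0 t))).

(* [e] contributes to the row of its source only; here its target entry has been
   erased from that row. *)
Let N : 'M[int]_n :=
  \matrix_(x, y) (laplacian s t x y + (x == v)%:R * (t e == y)%:R).

Let ME g0 x y : M g0 x y =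
  \sum_g (s g == x)%:R * ((s g == y)%:R - (g != g0)%:R * (t g == y)%:R)
  - (x == v)%:R * ((v == y)%:R - (e != g0)%:R * (t e == y)%:R).
Proof.
rewrite !mxE big_mkcond (bigD1 e) //= [X in _ = X - _](bigD1 e) //=.
rewrite split_off_lift eqxx /= add0r -/v [x == v]eq_sym [RHS]addrAC subrr.
rewrite !add0r.
apply: eq_bigr => g nge; rewrite !split_off_lift nge /=.
by case: (s g =P x) => _; rewrite ?mul0r ?mul1r // -mulnb natrM.
Qed.

Let ME_other g0 x y : t g0 = v -> y != v -> M g0 x y = N x y.
Proof.
move=> tg nyv; rewrite ME mxE laplacianE [v == y]eq_sym (negPf nyv) sub0r.
have drop g : (g != g0)%:R * (t g == y)%:R = (t g == y)%:R :> int.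
  by have [->|_] := eqVneq g g0; rewrite ?mul1r // tg eq_sym (negPf nyv) mulr0.
rewrite drop mulrN opprK; congr (_ + _).
by apply: eq_bigr => g _; rewrite drop.
Qed.

(** Column [v] counts the edges entering [v]; each of the [d] of them is redirected
    in one summand and present in the other [d - 1].  This uses that [d], the
    outdegree of [v], is also its indegree. *)
Let ME_sum x :
  \sum_(g0 | t g0 == v) M g0 x v = ((deg s v).-1)%:R * N x v.
Proof.
have d_gt0 : (0 < deg s v)%N by apply/card_gt0P; exists e; rewrite inE.
have dE : (deg s v)%:R = ((deg s v).-1)%:R + 1 :> int by rewrite natr1 prednK.
have count g : \sum_(g0 | t g0 == v) (g != g0)%:R * (t g == v)%:R
    = ((deg s v).-1)%:R * (t g == v)%:R :> int.
  rewrite -mulr_suml; case: eqP => [tg|_]; last by rewrite !mulr0.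
  congr (_ * _); rewrite (bigD1 g) /=; last exact/eqP.
  rewrite eqxx add0r (eq_bigr (fun=> 1)) => [|h /andP[_ nhg]]; last first.
    by rewrite eq_sym nhg.
  rewrite sumr_const; congr (_%:R).
  rewrite bal /deg [in RHS](cardD1 g) [in RHS]inE tg eqxx /=.
  by apply: eq_card => h; rewrite !inE andbC.
have const (c : int) : \sum_(g0 | t g0 == v) c = (deg s v)%:R * c.
  by rewrite sumr_const mulr_natl bal.
have loops : \sum_g (s g == x)%:R * (s g == v)%:R = (x == v)%:R * (deg s v)%:R :> int.
  rewrite degE mulr_sumr; apply: eq_bigr => g _.
  by case: (s g =P v) => [->|]; rewrite ?mulr0 // eq_sym.
under eq_bigr do rewrite ME.
rewrite sumrB exchange_big /= -mulr_sumr sumrB const count eqxx.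
under eq_bigr do rewrite -mulr_sumr sumrB const count.
rewrite mxE laplacianE.
under eq_bigr do rewrite mulrBr mulrCA [X in _ - X]mulrCA.
under [in RHS]eq_bigr do rewrite mulrBr.
rewrite !sumrB -!mulr_sumr loops dE mulr1.
by move: (deg s v).-1%:R (\sum_i _) (x == v)%:R (t e == v)%:R => D S X T; ring.
Qed.

(** The minors [M g0] agree outside column [v], so they can be expanded along this
    column with common cofactors. *)
Lemma sum_cofactor_split :
  \sum_(g0 | t g0 == s e)
      cofactor (laplacian (split_off e s) (split_off g0 t)) ord0 ord0
    = ((deg s v).-1)%:R * cofactor (laplacian s t) v (t e).
Proof.
have -> : cofactor (laplacian s t) v (t e) = \det N.
  rewrite det_add_row (det_zero_row_sums v (laplacian_row_sum s t)) add0r.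
  by under eq_bigr do rewrite eq_sym; rewrite sum_delta.
transitivity (\sum_(g0 | t g0 == v) \sum_x M g0 x v * cofactor N x v).
  apply: eq_bigr => g0 /eqP tg; rewrite /cofactor expr0 mul1r -/(M g0).
  rewrite (expand_det_col _ v); apply: eq_bigr => x _; congr (_ * _).
  by apply: eq_cofactor_col => a b nbv; apply: ME_other.
rewrite exchange_big (expand_det_col N v) mulr_sumr /=; apply: eq_bigr => x _.
by rewrite -mulr_suml ME_sum -mulrA.
Qed.

End SplitLaplacian.


Lemma surj_card_le (E : finType) n (s : E -> 'I_n) :
  (forall v, exists e, s e = v) -> (n <= #|E|)%N.
Proof.
move=> surj; rewrite -(card_ord n); apply: leq_trans (leq_image_card s E).
by apply/subset_leq_card/subsetP=> v _; have [e <-] := surj v; apply: image_f.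
Qed.

Lemma deg_gt0 (E : finType) n (s : E -> 'I_n) v :
  (exists e, s e = v) -> (0 < deg s v)%N.
Proof. by move=> [e <-]; apply/card_gt0P; exists e; rewrite inE. Qed.

(** The BEST theorem, by induction on the excess of edges over vertices. *)
Theorem card_transitions (E : finType) n (s t : E -> 'I_n) i j :
  (forall v, exists e, s e = v) -> balanced s t ->
  #|transitions s t|%:R =
    cofactor (laplacian s t) i j * \prod_v (((deg s v).-1)`!)%:R :> int.
Proof.
have [m] := ubnP (#|E| - n); elim: m n s t i j => // m IHm n s t i j le_m surj bal.
have all_cofactors i1 j1 i2 j2 :
    cofactor (laplacian s t) i1 j1 = cofactor (laplacian s t) i2 j2.
  apply: cofactor_zero_sums => [x|x]; first exact: laplacian_row_sum.
  exact: laplacian_col_sum.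
have [/injectiveP s_inj|/injectivePn[e [f nef sef]]] := boolP (injectiveb s).
  have [si siK] := fin_all_exists surj.
  have sK : cancel s si by move=> g; apply: s_inj.
  have deg1 v : deg s v = 1%N.
    rewrite -(card1 (si v)) /deg; apply: eq_card => g.
    by rewrite !inE -(inj_eq s_inj) siK.
  have t_inj : injective t.
    move=> g h tgh; have : (deg t (t h) <= 1)%N by rewrite -bal deg1.
    by move/card_le1_eqP; apply; rewrite inE ?tgh.
  rewrite big1 ?mulr1 => [|v _]; last by rewrite deg1.
  by rewrite -(cofactor_base sK siK t_inj i).
(* [e] and [f] leave the same vertex, so splitting [e] off leaves an edge there. *)
have surj' w : exists g, split_off e s g = w.
  case: (unliftP ord0 w) => [v|] ->; last first.
    by exists e; apply/eqP; rewrite split_off0.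
  have [g sg] := surj v; have [ge|nge] := eqVneq g e.
    exists f; apply/eqP.
    by rewrite split_off_lift eq_sym nef -sef -ge sg eqxx.
  by exists g; apply/eqP; rewrite split_off_lift nge sg eqxx.
have lt_nE : (n < #|E|)%N := surj_card_le surj'.
rewrite (card_transitions_split e) natr_sum.
under eq_bigr => g0 /eqP tg.
  rewrite (IHm _ _ _ ord0 ord0 _ surj' (balanced_split_off tg bal)); last first.
    move: le_m; rewrite ltnS subnS.
    by case: (#|E| - n)%N (subn_gt0 n #|E|) => //; rewrite lt_nE.
  over.
rewrite -mulr_suml sum_cofactor_split // mulrAC mulrC; congr (_ * _).
  exact: all_cofactors.
rewrite big_ord_recl deg_split_off0 mul1r.
rewrite (bigD1 (s e)) //= [RHS](bigD1 (s e)) //= mulrA; congr (_ * _).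
  rewrite (deg_split_off e) eqxx -natrM.
  have : (0 < deg (split_off e s) (lift ord0 (s e)))%N by exact: deg_gt0.
  by case: (deg _ _) => // d _; rewrite add1n /= factS mulnC.
by apply: eq_bigr => v nv; rewrite (deg_split_off e s v) eq_sym (negPf nv).
Qed.

(** * Connected graphs *)

Lemma sum_balanced (E : finType) n (s t : E -> 'I_n) (F : 'I_n -> int) :
  balanced s t -> \sum_g F (s g) = \sum_g F (t g).
Proof.
have count r : \sum_g F (r g) = \sum_i F i *+ deg r i.
  rewrite (partition_big r predT) //=; apply: eq_bigr => i _.
  by rewrite (eq_bigr (fun=> F i)) ?sumr_const // => g /eqP->.
by move=> bal; rewrite !count; apply: eq_bigr => i _; rewrite bal.
Qed.

(** Adding [1] at [(r, r)] turns the cofactor into a determinant, and the column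
    sums show that a vector in the kernel vanishes at [r].  Then it is in the
    kernel of the Laplacian, whose quadratic form forces it to be constant along
    the edges: the squares at the sources and at the targets have the same sum,
    so the form is half the sum of the [(u (s g) - u (t g)) ^+ 2]. *)
Lemma cofactor_connected_neq0 (E : finType) n (s t : E -> 'I_n) r :
  balanced s t ->
  (forall u : 'I_n -> int, (forall g, u (s g) = u (t g)) -> forall i, u i = u r) ->
  cofactor (laplacian s t) r r != 0.
Proof.
move=> bal conn; set L := laplacian s t.
have := det_add_row L r (fun y => (y == r)%:R).
rewrite (det_zero_row_sums r (laplacian_row_sum s t)) add0r sum_delta => <-.
rewrite -det_tr; apply/det0P=> -[w w_n0 /rowP Kw].
pose u i : int := w 0 i; have uE i : \sum_j L i j * u j + (i == r)%:R * u r = 0.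
  have := Kw i; rewrite [LHS]mxE [RHS]mxE => Ki; rewrite -[RHS]Ki; apply/esym.
  under eq_bigr => j _ do
    rewrite [_^T j i]mxE [(\matrix_(_, _) _) i j]mxE mulrC mulrDl -mulrA.
  by rewrite big_split /= -mulr_sumr sum_delta.
have ur0 : u r = 0.
  have : \sum_i (\sum_j L i j * u j + (i == r)%:R * u r) = 0.
    by apply: big1 => i _.
  rewrite big_split exchange_big /= big1 ?add0r => [|j _]; last first.
    by rewrite -mulr_suml laplacian_col_sum ?mul0r.
  by rewrite sum_delta.
have Lu i : \sum_j L i j * u j = 0 by rewrite -[RHS](uE i) ur0 mulr0 addr0.
have energy : \sum_g (u (s g) - u (t g)) ^+ 2 = 0.
  have step g i : \sum_j (s g == i)%:R * ((s g == j)%:R - (t g == j)%:R) * u j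
      = (s g == i)%:R * (u (s g) - u (t g)).
    under eq_bigr => j _ do rewrite -mulrA mulrBl.
    have pick k : \sum_j (k == j)%:R * u j = u k.
      by rewrite -[RHS](sum_delta k); apply: eq_bigr => j _; rewrite eq_sym.
    by rewrite -mulr_sumr sumrB !pick.
  have uLu : \sum_g u (s g) * (u (s g) - u (t g)) = 0.
    have Lu0 : \sum_i u i * \sum_j L i j * u j = 0.
      by apply: big1 => i _; rewrite Lu mulr0.
    rewrite -[RHS]Lu0.
    under [RHS]eq_bigr => i _.
      under eq_bigr do rewrite laplacianE mulr_suml.
      rewrite exchange_big mulr_sumr /=.
      under eq_bigr do rewrite step.
      over.
    rewrite exchange_big /=; apply: eq_bigr => g _.
    rewrite (bigD1 (s g)) //= eqxx mul1r big1 ?addr0 // => i.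
    by rewrite eq_sym => /negPf->; rewrite mul0r mulr0.
  have := sum_balanced (fun i => u i ^+ 2) bal.
  move/eqP; rewrite -subr_eq0 -sumrB => /eqP bal2.
  have : \sum_g (u (s g) * (u (s g) - u (t g)) *+ 2
                    - (u (s g) ^+ 2 - u (t g) ^+ 2)) = 0.
    by rewrite sumrB bal2 subr0 sumrMnl uLu mul0rn.
  by move=> sum0; rewrite -[RHS]sum0; apply: eq_bigr => g _; ring.
have flat g : u (s g) = u (t g).
  apply/eqP; rewrite -subr_eq0 -sqrf_eq0; apply/eqP.
  by apply: (psumr_eq0P _ energy) => // h _; apply: sqr_ge0.
case/eqP: w_n0; apply/rowP=> i; rewrite mxE -ur0.
exact: conn.
Qed.

(** * Determinants of matrices with constant fibre sums *)

Section FibreSums.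
Variables (R : comNzRingType) (n p : nat) (f : 'I_p -> 'I_n).
Variables (A : 'M[R]_n) (B : 'M[R]_(n + p)) (C : 'M[R]_p).

(** The indices [n + p] are thought of as lying over [n], the first [n] over
    themselves and the last [p] through [f].  Conjugation by the unitriangular
    matrix that adds to each of the first rows the other rows of its fibre makes
    [B] block triangular. *)
Lemma det_fibre_sums :
  (forall i j, B (lshift p i) (lshift p j)
      + \sum_(x | f x == i) B (rshift n x) (lshift p j) = A i j) ->
  (forall i y, B (lshift p i) (rshift n y)
      + \sum_(x | f x == i) B (rshift n x) (rshift n y) = A i (f y)) ->
  (forall x y, C x y = B (rshift n x) (rshift n y)
      - B (rshift n x) (lshift p (f y))) ->
  \det B = \det A * \det C.
Proof.
move=> BA BAr BC; pose T : 'M[R]_(n, p) := \matrix_(i, x) (f x == i)%:R.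
have TM m (X : 'M_(p, m)) i j : (T *m X) i j = \sum_(x | f x == i) X x j.
  rewrite mxE [RHS]big_mkcond; apply: eq_bigr => x _; rewrite mxE.
  by case: eqP; rewrite ?mul1r ?mul0r.
have MT m (X : 'M_(m, n)) i y : (X *m T) i y = X i (f y).
  rewrite mxE (bigD1 (f y)) //= mxE eqxx mulr1 big1 ?addr0 // => j.
  by rewrite eq_sym mxE => /negPf->; rewrite mulr0.
have conj : block_mx 1%:M T 0 1%:M *m B *m block_mx 1%:M (- T) 0 1%:M
    = block_mx A 0 (dlsubmx B) C.
  rewrite -[B in LHS]submxK !mulmx_block.
  rewrite !mul1mx !mul0mx !mulmx1 !mulmx0 !addr0 !add0r.
  congr block_mx.
  - apply/matrixP=> i j; rewrite mxE TM -BA !mxE; congr (_ + _).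
    by apply: eq_bigr => x _; rewrite !mxE.
  - apply/eqP; rewrite mulmxN addrC subr_eq0; apply/eqP/matrixP=> i y.
    rewrite MT [LHS]mxE [RHS]mxE !TM.
    transitivity (A i (f y)); [rewrite -BAr | rewrite -BA];
      by rewrite !mxE; congr (_ + _); apply: eq_bigr => x _; rewrite !mxE.
  apply/matrixP=> x y; rewrite mulmxN addrC [LHS]mxE [X in _ + X]mxE MT BC.
  by rewrite !mxE.
have /(congr1 determinant) := conj.
by rewrite !det_mulmx !det_ublock det_lblock !det1 !mul1r mulr1.
Qed.

End FibreSums.

(** Applying the adjugate to the product of [C] with the all-ones vector gives
    [\det C] in every coordinate, in particular in the first one. *)
Lemma dvdz_det_row_sums p (C : 'M[int]_p) (c : int) (z : 'I_p -> int) :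
  (0 < p)%N -> (forall x, \sum_y C x y = c * z x) -> (c %| \det C)%Z.
Proof.
case: p C z => // p C z _ Cz; apply/dvdzP.
exists (\sum_x \adj C ord0 x * z x).
have := mul_adj_mx C => /(congr1 (mulmx^~ (const_mx 1 : 'cV_p.+1))).
rewrite -mulmxA mul_scalar_mx => /matrixP/(_ ord0 ord0).
rewrite mxE [RHS]mxE [const_mx _ _ _]mxE mulr1 => <-.
rewrite mulr_suml; apply: eq_bigr => x _; rewrite -mulrA [z x * c]mulrC -Cz.
by congr (_ * _); rewrite mxE; apply: eq_bigr => y _; rewrite mxE mulr1.
Qed.

(** * Euler circuits as edge permutations *)

Lemma leq_card_imset_factor (T U W : finType) (A : {set T}) (f : T -> U) (h : T -> W) :
  {in A &, forall x y, f x = f y -> h x = h y} -> (#|h @: A| <= #|f @: A|)%N.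
Proof.
move=> fh; pose F (b : U) : option W :=
  omap h [pick x in A | f x == b].
have Some_inj : injective (@Some W) by move=> w1 w2 [].
rewrite -(card_imset _ Some_inj).
apply: leq_trans (leq_imset_card F _); apply/subset_leq_card/subsetP => w.
case/imsetP=> _ /imsetP[x Ax ->] ->; apply/imsetP; exists (f x); first exact: imset_f.
rewrite /F; case: pickP => [y /andP[Ay /eqP fyx]|/(_ x)] /=.
  by rewrite (fh y x).
by rewrite Ax eqxx.
Qed.

Section EulerTours.
Variable G : digraph.
Implicit Types (s u : #|edge G|.-tuple (edge G)) (q : {perm edge G}).

Lemma euler_tour_uniq s : euler_tour s -> uniq s /\ forall e, e \in (s : seq _).
Proof.
case/and4P=> _ _ /forallP once _.
have all_in e : e \in (s : seq _) by rewrite -has_pred1 has_count (eqP (once e)).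
split=> //; apply: (@leq_size_uniq _ (enum (edge G))) => //; first exact: enum_uniq.
by rewrite size_tuple -cardE.
Qed.

(** A tour is determined by its first edge and by the map from an edge to the next
    one, and the first edge can be changed by a rotation. *)
Lemma same_circuit_next s u : euler_tour s -> euler_tour u ->
  same_circuit s u <-> next s =1 next u.
Proof.
move=> /euler_tour_uniq[s_uniq s_all] /euler_tour_uniq[u_uniq u_all].
split=> [/existsP[i /eqP us] e | next_su]; first by rewrite us next_rot.
have size_su : size s = size u by rewrite !size_tuple.
have us_cycle : fcycle (next s) u.
  by rewrite (eq_fcycle next_su); apply: cycle_next.
case def_u: (val u) us_cycle size_su => [|x u'] u_cyc size_su.
  apply/existsP; exists ord0; rewrite def_u.
  by move: size_su; case: (val s).
have /(rot_index) def_s := s_all x.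
set i := index x s in def_s; set s' := (X in x :: X) in def_s.
have lt_i : (i < #|edge G|.+1)%N.
  by rewrite ltnS -[X in (_ <= X)%N](size_tuple s) index_size.
apply/existsP; exists (Ordinal lt_i).
rewrite def_u /= def_s; apply/eqP; congr (_ :: _).
have s_cyc : fcycle (next s) (x :: s').
  by rewrite -def_s rot_cycle; apply: cycle_next.
have size_s' : size s' = size u'.
  apply: succn_inj; rewrite -[LHS]/(size (x :: s')) -def_s size_rot size_su //.
move: s_cyc u_cyc => /= /fpathP[m Es] /fpathP[m' Eu].
have mm' : m = m'.
  have := congr1 size Es; have := congr1 size Eu.
  by rewrite !size_rcons !size_traject size_s' => ->.
have: rcons s' x = rcons u' x by rewrite Es Eu mm'.
by case/rcons_inj.
Qed.

Lemma card_euler_circuits_next :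
  num_euler_circuits G
    = #|(fun s => [ffun e => next s e]) @: [set s | @euler_tour G s]|.
Proof.
set D := [set s | _]; set f := fun s => _.
have same_f : {in D &, forall s u, same_circuit s u <-> f s = f u}.
  move=> s u; rewrite !inE => s_tour u_tour; rewrite same_circuit_next //.
  split=> [next_su | /ffunP next_su e]; first by apply/ffunP=> e; rewrite !ffunE.
  by have := next_su e; rewrite !ffunE.
rewrite /num_euler_circuits /euler_circuits -/D.
have -> : equivalence_partition (@same_circuit G) D
    = (fun s => [set u in D | same_circuit s u]) @: D by [].
apply/eqP; rewrite eqn_leq; apply/andP; split;
  apply: leq_card_imset_factor => s u Ds Du.
  move=> fsu; apply/setP=> w; rewrite [LHS]inE [RHS]inE.
  case Dw: (w \in D) => //=.
  apply/idP/idP=> [/(same_f _ _ Ds Dw)|/(same_f _ _ Du Dw)] fw.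
    by apply/(same_f _ _ Du Dw); rewrite -fsu.
  by apply/(same_f _ _ Ds Dw); rewrite fsu.
move/setP/(_ u); rewrite !inE; have := Du; rewrite inE => -> /= su.
by apply/(same_f _ _ Ds Du); rewrite su; apply/(same_f _ _ Du Du).
Qed.

(** Consecutive edges of a tour form a permutation of the edges, and conversely
    the powers of such a permutation list the edges of a tour. *)
Lemma next_euler_tours :
  (0 < #|edge G|)%N -> (forall v : vertex G, 0 < outdeg v)%N ->
  (fun s => [ffun e => next s e]) @: [set s | @euler_tour G s]
    = (fun q => [ffun e => q e]) @: [set q : {perm edge G} |
         [forall e, src (q e) == tgt e] && single_cycle q].
Proof.
move=> E_gt0 out_gt0; apply/setP=> F; apply/imsetP/imsetP=> -[].
  move=> s; rewrite inE => s_tour ->; have [s_uniq s_all] := euler_tour_uniq s_tour.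
  pose q := perm (can_inj (prev_next s_uniq)).
  exists q; last by apply/ffunP=> e; rewrite !ffunE permE.
  rewrite inE; apply/andP; split.
    apply/forallP=> e; rewrite permE eq_sym; case/and4P: s_tour => _ s_cyc _ _.
    exact: (next_cycle s_cyc (s_all e)).
  apply/forallP=> x; apply/forallP=> y.
  have : fconnect (next s) x y by rewrite (fconnect_cycle (cycle_next s_uniq)) s_all.
  move/iter_findex <-; rewrite (eq_iter (f' := q)) => [|e]; last by rewrite permE.
  by rewrite -permX mem_porbit.
move=> q; rewrite inE => /andP[/forallP q_step /forallP q_cyc] ->.
have all_porbit x y : y \in porbit q x := forallP (q_cyc x) y.
case/card_gt0P: (E_gt0) => x0 _.
have card_x0 : #|porbit q x0| = #|edge G| by apply: eq_card => y; rewrite all_porbit.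
have size_s : size (traject q x0 #|edge G|) == #|edge G| by rewrite size_traject.
pose s := Tuple size_s.
have s_uniq : uniq s by rewrite /= -card_x0 uniq_traject_porbit.
have s_all e : e \in (s : seq _) by rewrite /= -card_x0 -porbit_traject.
have s_cyc : fcycle q s.
  rewrite /= -card_x0; case: #|_| (iter_porbit q x0) => //= m qm.
  have -> : rcons (traject q (q x0) m) x0 = traject q (q x0) m.+1.
    by rewrite trajectSr -iterSr /= qm.
  exact: fpath_traject.
exists s; last by apply/ffunP=> e; rewrite !ffunE (nextE s_cyc).
rewrite inE; apply/and4P; split.
- by rewrite -size_eq0 size_tuple -lt0n.
- by apply: sub_cycle s_cyc => e f /= /eqP <-; rewrite eq_sym.
- by apply/forallP=> e; rewrite (count_uniq_mem _ s_uniq) s_all.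
apply/forallP=> v; have /card_gt0P[e] := out_gt0 v; rewrite inE => src_e.
by apply/hasP; exists e.
Qed.

Lemma num_euler_circuits_transitions n (num : vertex G -> 'I_n) : injective num ->
  (0 < #|edge G|)%N -> (forall v : vertex G, 0 < outdeg v)%N ->
  num_euler_circuits G = #|transitions (num \o @src G) (num \o @tgt G)|.
Proof.
move=> num_inj E_gt0 out_gt0.
rewrite card_euler_circuits_next next_euler_tours // card_imset.
  apply: eq_card => q; rewrite !inE; congr (_ && _).
  by apply: eq_forallb => e; rewrite /= (inj_eq num_inj).
by move=> q r /ffunP eq_qr; apply/permP=> e; have := eq_qr e; rewrite !ffunE.
Qed.

End EulerTours.

Lemma laplacian_edgesE (E : finType) n (s t : E -> 'I_n) i j :
  laplacian s t i j =
    (i == j)%:R * (deg s i)%:R - #|[set g | (s g == i) && (t g == j)]|%:R.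
Proof.
rewrite laplacianE; under eq_bigr do rewrite mulrBr.
rewrite sumrB; congr (_ - _).
  rewrite degE mulr_sumr; apply: eq_bigr => g _.
  by case: (s g =P i) => [->|]; rewrite ?mulr1 ?mul1r ?mulr0 ?mul0r.
rewrite -sum1dep_card natr_sum [RHS]big_mkcond /=; apply: eq_bigr => g _.
by do 2 case: eqP => _ //=; rewrite ?mulr1 ?mul0r.
Qed.

(** Consecutive edges of a tour pair the edges entering a vertex with those
    leaving it. *)
Lemma transitions_balanced (E : finType) n (s t : E -> 'I_n) q :
  q \in transitions s t -> balanced s t.
Proof.
case/transitionsP=> st _ i; rewrite /deg -!sum1_card (reindex_inj (@perm_inj _ q)) /=.
by apply: eq_bigl => g; rewrite !inE st.
Qed.

Lemma has_euler_circuit_edges (G : digraph) : has_euler_circuit G ->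
  [/\ 0 < #|edge G|, forall v : vertex G, 0 < outdeg v & 0 < num_euler_circuits G]%N.
Proof.
case=> s s_tour; have := s_tour; case/and4P=> s_n0 _ _ /forallP vis; split.
- by rewrite -(size_tuple s) lt0n size_eq0.
- by move=> v; have /hasP[e _ src_e] := vis v; apply/card_gt0P; exists e; rewrite inE.
rewrite card_euler_circuits_next; apply/card_gt0P.
by eexists; apply: imset_f; rewrite inE; exact: s_tour.
Qed.

Lemma num_euler_circuits_cofactor (G : digraph) n (num : vertex G -> 'I_n) i j :
  bijective num -> (0 < #|edge G|)%N -> (forall v : vertex G, 0 < outdeg v)%N ->
  balanced (num \o @src G) (num \o @tgt G) ->
  (num_euler_circuits G)%:R =
    cofactor (laplacian (num \o @src G) (num \o @tgt G)) i j
    * \prod_(v : vertex G) (((outdeg v).-1)`!)%:R :> int.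
Proof.
move=> num_bij E_gt0 out_gt0 bal; have num_inj := bij_inj num_bij.
rewrite (num_euler_circuits_transitions num_inj) // (card_transitions i j) //.
  congr (_ * _); rewrite (reindex num) /=; last exact: onW_bij.
  apply: eq_bigr => v _; congr ((_.-1)`!)%:R.
  by apply: eq_card => e; rewrite !inE /= (inj_eq num_inj).
move=> v; have [inv _ numK] := num_bij.
have /card_gt0P[e] := out_gt0 (inv v); rewrite inE => /eqP src_e.
by exists e; rewrite /= src_e numK.
Qed.

(** * Covers *)

Section Cover.
Variables (G H : digraph) (pV : vertex H -> vertex G) (pE : edge H -> edge G).
Variable k : nat.
Hypothesis cover : kfold_cover pV pE k.

Lemma sum_out_edges (R : nmodType) (F : edge G -> R) w :
  \sum_(g in out_edges w) F (pE g) = \sum_(e in out_edges (pV w)) F e.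
Proof.
by rewrite -(cover_out_onto cover) big_imset //; apply: (cover_out_inj cover).
Qed.

Lemma sum_in_edges (R : nmodType) (F : edge G -> R) w :
  \sum_(g in in_edges w) F (pE g) = \sum_(e in in_edges (pV w)) F e.
Proof.
by rewrite -(cover_in_onto cover) big_imset //; apply: (cover_in_inj cover).
Qed.

Lemma outdeg_cover w : outdeg w = outdeg (pV w).
Proof. by rewrite /outdeg -!sum1_card (sum_out_edges (fun=> 1%N)). Qed.

Lemma card_in_edges_cover w : #|in_edges w| = #|in_edges (pV w)|.
Proof. by rewrite -!sum1_card (sum_in_edges (fun=> 1%N)). Qed.

Lemma prod_cover (R : comNzRingType) (F : vertex G -> R) :
  \prod_w F (pV w) = \prod_v F v ^+ k.
Proof.
rewrite (partition_big pV predT) //=; apply: eq_bigr => v _.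
rewrite (eq_bigr (fun=> F v)) => [|w /eqP-> //]; rewrite prodr_const.
rewrite -(cover_fiberV cover v); congr (_ ^+ _).
by apply: eq_card => w; rewrite !inE.
Qed.

Lemma card_cover : #|vertex H| = (#|vertex G| * k)%N.
Proof.
rewrite -sum1_card (partition_big pV predT) //= -sum_nat_const.
apply: eq_bigr => v _; rewrite -(cover_fiberV cover v) -sum1_card.
by apply: eq_bigl => w; rewrite !inE.
Qed.

End Cover.

Section Labelled.
Variables (n k : nat) (G H : digraph).
Variables (pV : vertex H -> vertex G) (pE : edge H -> edge G).
Variables (v : 'I_n -> vertex G) (vl : 'I_n -> 'I_k.+1 -> vertex H).
Variable num : vertex G -> 'I_n.
Hypotheses (cover : kfold_cover pV pE k.+1) (hvl : lift_labelling pV v vl).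
Hypotheses (vK : cancel v num) (numK : cancel num v).

Let p := (\sum_(t < k) n)%N.
Let base (y : 'I_p) : 'I_n := tagnat.sig2 y.
Let layer (y : 'I_p) : 'I_k := tagnat.sig1 y.

(** The rows of the Laplacian of [H], listed so that the first lifts of the
    vertices come first and the others follow in the order of the rows of
    [cover_laplacian]. *)
Definition lift_vertex (x : 'I_(n + p)) : vertex H :=
  match split x with
  | inl i => vl i ord0
  | inr y => vl (base y) (lift ord0 (layer y))
  end.

Lemma lift_vertexl i : lift_vertex (lshift p i) = vl i ord0.
Proof. by rewrite /lift_vertex -[lshift p i]/(unsplit (inl i)) unsplitK. Qed.

Lemma lift_vertexr y :
  lift_vertex (rshift n y) = vl (base y) (lift ord0 (layer y)).
Proof. by rewrite /lift_vertex -[rshift n y]/(unsplit (inr y)) unsplitK. Qed.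

Lemma pV_vl i t : pV (vl i t) = v i.
Proof.
have [_ img] := hvl i; have : vl i t \in pV @^-1: [set v i].
  by rewrite -img; apply: imset_f.
by rewrite !inE => /eqP.
Qed.

Let vl_inj i j t r : vl i t = vl j r -> i = j /\ t = r.
Proof.
move=> eq_vl; have ij : i = j.
  by apply: (can_inj vK); rewrite -(pV_vl i t) eq_vl pV_vl.
by split=> //; move: eq_vl; rewrite ij; have [inj _] := hvl j; apply: inj.
Qed.

Let base_layer_inj y z : base y = base z -> layer y = layer z -> y = z.
Proof.
move=> eb el; rewrite -[y]tagnat.sig2K -[z]tagnat.sig2K.
rewrite -[tagnat.sig2 y]/(base y) -[tagnat.sig2 z]/(base z).
rewrite -[tagnat.sig1 y]/(layer y) -[tagnat.sig1 z]/(layer z).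
exact: (f_equal2 (fun a b => @tagnat.Rank k (fun=> n) a b) el eb).
Qed.

Lemma lift_vertex_bij : bijective lift_vertex.
Proof.
have inj : injective lift_vertex.
  move=> x y; case: (split_ordP x) => a ->; case: (split_ordP y) => b ->;
    rewrite ?lift_vertexl ?lift_vertexr => /vl_inj[].
  - by move->.
  - by move=> _ /eqP; rewrite (negPf (neq_lift _ _)).
  - by move=> _ /eqP; rewrite eq_sym (negPf (neq_lift _ _)).
  - by move=> eb /lift_inj el; rewrite (base_layer_inj eb el).
apply: inj_card_bij inj _; rewrite (card_cover cover) card_ord.
rewrite -(bij_eq_card (Bijective vK numK)) card_ord.
by rewrite /p sum_nat_const card_ord mulnS mulnC.
Qed.

Variable numH : vertex H -> 'I_(n + p).
Hypotheses (liftK : cancel lift_vertex numH) (numHK : cancel numH lift_vertex).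

Let LG := laplacian (num \o @src G) (num \o @tgt G).
Let LH := laplacian (numH \o @src H) (numH \o @tgt H).
Let C : 'M[int]_p := map_mx (meval (fun=> 1)) (cover_laplacian pE vl).
Let fibre (x : 'I_(n + p)) : 'I_n := num (pV (lift_vertex x)).

Let fibrel i : fibre (lshift p i) = i.
Proof. by rewrite /fibre lift_vertexl pV_vl vK. Qed.

Let fibrer y : fibre (rshift n y) = base y.
Proof. by rewrite /fibre lift_vertexr pV_vl vK. Qed.

Let numH_eq w x : (numH w == x) = (w == lift_vertex x).
Proof. by rewrite -[x in LHS]liftK (can_eq numHK). Qed.

Let sum_fibre (F : 'I_(n + p) -> int) i :
  \sum_(x | fibre x == i) F x
    = F (lshift p i) + \sum_(y | base y == i) F (rshift n y).
Proof.
rewrite big_split_ord /=; congr (_ + _).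
  by rewrite (big_pred1 i) // => a; rewrite fibrel.
by apply: eq_bigl => y; rewrite fibrer.
Qed.

(** The edges that leave or enter a vertex of [H] correspond to those at its
    projection, so adding up the rows of a fibre amounts to counting edges of
    [G]. *)
Let LH_fibre i y : \sum_(x | fibre x == i) LH x y = LG i (fibre y).
Proof.
have indicator (I : finType) (P Q : pred I) :
    \sum_(g : I) (P g)%:R * (Q g)%:R = \sum_(g | Q g) (P g)%:R :> int.
  rewrite [RHS]big_mkcond; apply: eq_bigr => g _.
  by case: (Q g); rewrite ?mulr1 ?mulr0.
transitivity (\sum_g (num (src (pE g)) == i)%:R
    * ((src g == lift_vertex y)%:R - (tgt g == lift_vertex y)%:R) : int).
  under eq_bigr do rewrite laplacianE.
  rewrite exchange_big /=; apply: eq_bigr => g _.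
  rewrite -mulr_suml /= !numH_eq; congr (_ * _).
  rewrite (cover_src cover); under eq_bigr do rewrite eq_sym.
  rewrite big_mkcond (bigD1 (numH (src g))) //= eqxx big1 ?addr0 => [|x /negPf->].
    by rewrite /fibre numHK; case: eqP.
  by case: ifP.
rewrite /LG laplacianE /=.
under eq_bigr do rewrite mulrBr.
under [RHS]eq_bigr do rewrite mulrBr.
rewrite !sumrB !indicator; congr (_ - _).
  have := sum_out_edges cover (fun e => (num (src e) == i)%:R : int) (lift_vertex y).
  rewrite (eq_bigl (fun g => src g == lift_vertex y)) => [->|g]; last by rewrite inE.
  by apply: eq_bigl => e; rewrite inE -(inj_eq (can_inj numK)).
have := sum_in_edges cover (fun e => (num (src e) == i)%:R : int) (lift_vertex y).
rewrite (eq_bigl (fun g => tgt g == lift_vertex y)) => [->|g]; last by rewrite inE.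
by apply: eq_bigl => e; rewrite inE -(inj_eq (can_inj numK)).
Qed.

Let LHE x y : LH x y = (x == y)%:R * (outdeg (lift_vertex x))%:R
  - #|edges_from_to (lift_vertex x) (lift_vertex y)|%:R.
Proof.
rewrite /LH laplacian_edgesE; congr (_ * _%:R - _%:R); apply: eq_card => g.
  by rewrite !inE /= numH_eq.
by rewrite !inE /= !numH_eq.
Qed.

Let meval_cwt (A : {set edge H}) :
  (\sum_(e in A) cwt pE e).@[fun=> 1] = #|A|%:R :> int.
Proof.
rewrite rmorph_sum /= -[in RHS]sum1_card natr_sum; apply: eq_bigr => e _.
by rewrite /cwt /wt mevalXU.
Qed.

Lemma cover_laplacianE x y :
  C x y = LH (rshift n x) (rshift n y) - LH (rshift n x) (lshift p (base y)).
Proof.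
rewrite !LHE eq_rlshift mul0r sub0r opprK !lift_vertexr lift_vertexl.
rewrite (inj_eq (@rshift_inj n p)).
rewrite !mxE !mevalB !meval_cwt -!/(layer _) -!/(base _).
rewrite opprB addrA addrAC; congr (_ - _ + _).
have [eql|nel] := eqVneq (layer x) (layer y); last first.
  have /negPf-> : x != y by apply: contraNneq nel => ->.
  by rewrite mxE meval0 mul0r.
rewrite conform_mx_id !mxE mevalMn meval_cwt mulr_natl; congr (_ *+ _).
congr nat_of_bool; apply/eqP/eqP=> [eqb|-> //].
exact: base_layer_inj.
Qed.

Let fibre_size i : \sum_y (fibre y == i)%:R = k.+1%:R :> int.
Proof.
rewrite -natr_sum -(cover_fiberV cover (v i)) -[in RHS]sum1_card; congr (_%:R).
rewrite (reindex numH) /=; last by exists lift_vertex => w _; rewrite ?liftK ?numHK.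
rewrite [RHS]big_mkcond; apply: eq_bigr => w _.
by rewrite /fibre numHK !inE -(inj_eq (can_inj vK)) numK; case: eqP.
Qed.

(** The Laplacians are perturbed by a unit row vector at vertex [i] of [G] and by
    the indicator of the fibre of [i] at a vertex of this fibre.  The second row
    vector is the pull-back of the first one, as [det_fibre_sums] requires, and it
    selects [k + 1] cofactors. *)
Lemma cofactor_cover i x :
  balanced (num \o @src G) (num \o @tgt G) ->
  balanced (numH \o @src H) (numH \o @tgt H) ->
  k.+1%:R * cofactor LH x x = cofactor LG i i * \det C.
Proof.
move=> balG balH.
have LH_cofactors a b : cofactor LH a b = cofactor LH x x.
  apply: cofactor_zero_sums => z; first exact: laplacian_row_sum.
  exact: laplacian_col_sum.
have := det_add_row LG i (fun j => (j == i)%:R).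
rewrite (det_zero_row_sums i (laplacian_row_sum _ _)) add0r sum_delta => <-.
have := det_add_row LH (lshift p i) (fun y => (fibre y == i)%:R).
rewrite (det_zero_row_sums (lshift p i) (laplacian_row_sum _ _)) add0r.
under [X in _ = X -> _]eq_bigr do rewrite LH_cofactors.
rewrite -mulr_suml fibre_size => <-.
have B_fibre a y : \sum_(x | fibre x == a)
    (LH x y + (x == lshift p i)%:R * (fibre y == i)%:R)
  = LG a (fibre y) + (a == i)%:R * (fibre y == i)%:R.
  rewrite big_split LH_fibre -mulr_suml; congr (_ + _ * _).
  rewrite big_mkcond (bigD1 (lshift p i)) //= eqxx big1 ?addr0 => [|b /negPf->].
    by rewrite fibrel eq_sym; case: eqP.
  by case: ifP.
apply: (det_fibre_sums (f := base)) => [a j|a y|a y].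
- have := B_fibre a (lshift p j); rewrite sum_fibre fibrel => E0.
  rewrite [RHS]mxE -E0 !mxE fibrel; congr (_ + _).
  by apply: eq_bigr => z _; rewrite !mxE fibrel.
- have := B_fibre a (rshift n y); rewrite sum_fibre fibrer => E0.
  rewrite [RHS]mxE -E0 !mxE fibrer; congr (_ + _).
  by apply: eq_bigr => z _; rewrite !mxE fibrer.
rewrite cover_laplacianE [X in _ = X - _]mxE [X in _ = _ - X]mxE.
by rewrite eq_rlshift !mul0r !addr0.
Qed.

(** The sum of a row of [C] is that of the last entries of a row of the Laplacian,
    minus [k] times that of its first [n] entries.  The two sums are opposite, so
    the result is [- (k + 1)] times the second one. *)
Lemma dvdz_det_cover (i : 'I_n) : (k.+1%:Z %| \det C)%Z.
Proof.
have [k0|k_gt0] := posnP k; first by rewrite k0 dvd1z.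
have p_gt0 : (0 < p)%N.
  by rewrite /p sum_nat_const card_ord muln_gt0 k_gt0 (leq_trans _ (ltn_ord i)).
pose z x := - \sum_a LH (rshift n x) (lshift p a).
apply: (@dvdz_det_row_sums _ _ _ z) => // x; rewrite /z.
under eq_bigr do rewrite cover_laplacianE.
rewrite sumrB.
have base_size a : \sum_(y | base y == a) 1 = k%:R :> int.
  have := sum_fibre (fun=> 1) a; rewrite sumr_const.
  have -> : #|[pred x | fibre x == a]| = k.+1.
    apply/eqP; rewrite -(eqr_nat int) -(fibre_size a) -sum1_card natr_sum big_mkcond.
    by apply/eqP/eq_bigr => y _; rewrite inE; case: eqP.
  by rewrite -natr1 addrC => /addrI ->.
have -> : \sum_y LH (rshift n x) (lshift p (base y))
    = k%:R * \sum_a LH (rshift n x) (lshift p a).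
  rewrite (partition_big base predT) //= mulr_sumr; apply: eq_bigr => a _.
  rewrite -(base_size a) mulr_suml; apply: eq_bigr => y /eqP->; exact/esym/mul1r.
have := laplacian_row_sum (numH \o @src H) (numH \o @tgt H) (rshift n x).
rewrite big_split_ord /= -/LH addrC => /eqP; rewrite addr_eq0 => /eqP->.
by rewrite -natz -natr1; ring.
Qed.

End Labelled.

(** * Euler circuits of covers *)

Lemma num_euler_circuits_gt0 (G : digraph) n (num : vertex G -> 'I_n) (r : 'I_n) :
  bijective num -> (0 < #|edge G|)%N -> (forall v : vertex G, 0 < outdeg v)%N ->
  balanced (num \o @src G) (num \o @tgt G) -> connected G ->
  (0 < num_euler_circuits G)%N.
Proof.
move=> num_bij E_gt0 out_gt0 bal conn; rewrite lt0n -(eqr_nat int).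
rewrite (num_euler_circuits_cofactor r r num_bij) //.
rewrite mulf_neq0 //; last first.
  by apply/prodf_neq0 => v _; rewrite pnatr_eq0 -lt0n fact_gt0.
apply: cofactor_connected_neq0 => // u flat i.
have [inv _ numK] := num_bij; rewrite -(numK i) -(numK r).
have /connectP[w wP ->] := conn (inv i) (inv r).
elim: w (inv i) wP => //= y w IHw x /andP[/existsP[e xy] /IHw <-].
have := flat e; rewrite /=.
by case/orP: xy => /andP[/eqP-> /eqP->].
Qed.

Theorem corollary1p9 (n k : nat) (G H : digraph)
    (pV : vertex H -> vertex G) (pE : edge H -> edge G)
    (v : 'I_n -> vertex G) (vl : 'I_n -> 'I_k.+1 -> vertex H)
    (hG : has_euler_circuit G)
    (hcover : kfold_cover pV pE k.+1)
    (hv : bijective v)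
    (hvl : lift_labelling pV v vl) :
  (num_euler_circuits H)%:R / (num_euler_circuits G)%:R
    = (k.+1)%:R^-1
      * ((\det (cover_laplacian pE vl)).@[fun=> 1])%:~R
      * \prod_(w : vertex G) (((outdeg w).-1)`!)%:R ^+ k :> rat
  /\ exists N : nat,
       (num_euler_circuits H)%:R / (num_euler_circuits G)%:R = N%:R :> rat
       /\ (connected H -> (0 < N)%N).
Proof.
have [num vK numK] := hv.
have [EG_gt0 outG_gt0 eulerG_gt0] := has_euler_circuit_edges hG.
have num_bij : bijective num := Bijective numK vK.
have balG : balanced (num \o @src G) (num \o @tgt G).
  move: eulerG_gt0; rewrite (num_euler_circuits_transitions (bij_inj num_bij)) //.
  by case/card_gt0P => q /transitions_balanced.
have outH_gt0 (w : vertex H) : (0 < outdeg w)%N by rewrite (outdeg_cover hcover).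
have EH_gt0 : (0 < #|edge H|)%N.
  have /card_gt0P[e _] := EG_gt0.
  have : (0 < #|pE @^-1: [set e]|)%N by rewrite (cover_fiberE hcover).
  by case/card_gt0P=> g _; apply/card_gt0P; exists g.
have /card_gt0P[e0 _] := EG_gt0; pose i := num (src e0).
have [numH liftK numHK] := lift_vertex_bij hcover hvl vK numK.
have numH_bij : bijective numH := Bijective numHK liftK.
have balH : balanced (numH \o @src H) (numH \o @tgt H).
  have deg_num (K : digraph) m (f : vertex K -> 'I_m) h w : injective f ->
      deg (f \o h) (f w) = #|[set e : edge K | h e == w]|.
    by move=> f_inj; apply: eq_card => e; rewrite !inE /= (inj_eq f_inj).
  move=> x; rewrite -(liftK x); set w := lift_vertex vl x.
  rewrite !(deg_num _ _ _ _ _ (bij_inj numH_bij)) -/(in_edges w) -[LHS]/(outdeg w).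
  rewrite (outdeg_cover hcover) (card_in_edges_cover hcover).
  by have := balG (num (pV w)); rewrite !(deg_num _ _ _ _ _ (can_inj numK)).
pose x := numH (vl i ord0).
have eulerG := num_euler_circuits_cofactor i i num_bij EG_gt0 outG_gt0 balG.
have eulerH := num_euler_circuits_cofactor x x numH_bij EH_gt0 outH_gt0 balH.
have cof := cofactor_cover hcover hvl vK numK liftK numHK i x balG balH.
have /dvdzP[z detE] := dvdz_det_cover hcover hvl vK numK liftK numHK i.
rewrite det_map_mx in detE cof.
pose Q : int := \prod_(w : vertex G) (((outdeg w).-1)`!)%:R ^+ k.
have k1_n0 (F : numDomainType) : k.+1%:R != 0 :> F by rewrite pnatr_eq0.
have ratio : (num_euler_circuits H)%:R = (num_euler_circuits G)%:R * (z * Q) :> int.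
  rewrite eulerH eulerG mulrACA; congr (_ * _).
    by apply: (mulfI (k1_n0 _)); rewrite cof detE -natz [RHS]mulrC mulrA.
  under eq_bigr do rewrite (outdeg_cover hcover).
  rewrite (prod_cover hcover (fun w => (((outdeg w).-1)`!)%:R)) -big_split /=.
  by apply: eq_bigr => w _; rewrite exprS.
have eulerG_n0 : (num_euler_circuits G)%:R != 0 :> rat by rewrite pnatr_eq0 -lt0n.
have ratioQ : (num_euler_circuits H)%:R / (num_euler_circuits G)%:R
    = (z * Q)%:~R :> rat.
  apply: (mulIf eulerG_n0); rewrite divfK // mulrC.
  by have := congr1 (fun a : int => a%:~R : rat) ratio; rewrite rmorphM !rmorph_nat.
split.
  rewrite ratioQ detE !rmorphM /= -pmulrn [_^-1 * _]mulrC mulfK ?k1_n0 //.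
  congr (_ * _); rewrite rmorph_prod; apply: eq_bigr => w _.
  by rewrite rmorphXn /= rmorph_nat.
exists (absz (z * Q)); have zQ_ge0 : 0 <= z * Q.
  have : 0 <= (z * Q)%:~R :> rat by rewrite -ratioQ divr_ge0 ?ler0n.
  by rewrite ler0z.
rewrite ratioQ; split; first by rewrite -[in LHS](gez0_abs zQ_ge0) -pmulrn.
move=> /(num_euler_circuits_gt0 x numH_bij EH_gt0 outH_gt0 balH).
rewrite absz_gt0 -(ltr0n int) ratio; apply: contraL => /eqP->.
by rewrite mulr0 ltxx.
Qed.
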